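(* Let $2\leq k<n$ and let $K\subset\mathbb{C}^n$ be a convex body such that for every complex $k$-dimensional linear subspace $P\subset\mathbb{C}^n$, the orthogonal projection of $K$ onto $P$ is a (complex) ellipsoid in $P$. Then $K$ is an ellipsoid.
   Context: A convex body is a compact convex subset of $\mathbb{C}^n$ with nonempty interior. A (complex) ellipsoid in a complex affine space of dimension $m$ is the image of the closed Euclidean unit ball of $\mathbb{C}^m$ under an injective complex affine map into that space. Orthogonal projections are with respect to the standard Hermitian inner product on $\mathbb{C}^n$. *)

(* Defs.v *)
From HB Require Import structures.
From mathcomp Require Import all_boot all_order all_algebra.
From mathcomp Require Import complex.
From mathcomp Require Import reals.
Set Implicit Arguments. Unset Strict Implicit. Unset Printing Implicit Defensive.
Import Order.TTheory GRing.Theory Num.Theory.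
Local Open Scope ring_scope.
Local Open Scope complex_scope.

Section Defs.
Variable R : realType.
Local Notation C := R[i].

Definition cnorm2 (z : C) : R := let: a +i* b := z in a ^+ 2 + b ^+ 2.

Definition vnorm2 (m : nat) (v : 'rV[C]_m) : R := \sum_(i < m) cnorm2 (v 0 i).

Definition hdot (m : nat) (u v : 'rV[C]_m) : C := \sum_(i < m) u 0 i * conjc (v 0 i).

Definition unit_ball (m : nat) (x : 'rV[C]_m) : Prop := vnorm2 x <= 1.

Definition bounded_set (n : nat) (K : 'rV[C]_n -> Prop) : Prop :=
  exists M : R, forall v, K v -> vnorm2 v <= M.

Definition closed_set (n : nat) (K : 'rV[C]_n -> Prop) : Prop :=
  forall v, (forall e : R, 0 < e -> exists w, K w /\ vnorm2 (v - w) < e) -> K v.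

(* compact = closed and bounded (Heine-Borel in C^n ~ R^{2n}) *)
Definition compact_set (n : nat) (K : 'rV[C]_n -> Prop) : Prop :=
  closed_set K /\ bounded_set K.

Definition convex_set (n : nat) (K : 'rV[C]_n -> Prop) : Prop :=
  forall u v (t : R), K u -> K v -> 0 <= t <= 1 ->
    K ((t%:C) *: u + ((1 - t)%:C) *: v).

Definition nonempty_interior (n : nat) (K : 'rV[C]_n -> Prop) : Prop :=
  exists v (e : R), 0 < e /\ forall w, vnorm2 (w - v) < e -> K w.

Definition convex_body (n : nat) (K : 'rV[C]_n -> Prop) : Prop :=
  [/\ compact_set K, convex_set K & nonempty_interior K].

Definition in_subspace (n : nat) (P : 'M[C]_n) (v : 'rV[C]_n) : Prop :=
  (v <= P)%MS.

Definition is_orth_proj (n : nat) (P : 'M[C]_n) (v w : 'rV[C]_n) : Prop :=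
  in_subspace P w /\ forall u, in_subspace P u -> hdot (v - w) u = 0.

Definition orth_proj_set (n : nat) (P : 'M[C]_n) (K : 'rV[C]_n -> Prop)
  : 'rV[C]_n -> Prop :=
  fun w => exists v, K v /\ is_orth_proj P v w.

Definition ellipsoid_in (n m : nat) (P : 'M[C]_n) (S : 'rV[C]_n -> Prop) : Prop :=
  exists (a : 'rV[C]_n) (A : 'M[C]_(m, n)),
    (forall x : 'rV[C]_m, in_subspace P (a + x *m A)) /\
    injective (fun x : 'rV[C]_m => a + x *m A) /\
    (forall w, S w <-> exists x, unit_ball x /\ w = a + x *m A).

Definition ellipsoid (n : nat) (S : 'rV[C]_n -> Prop) : Prop :=
  exists (a : 'rV[C]_n) (A : 'M[C]_n),
    injective (fun x : 'rV[C]_n => a + x *m A) /\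
    (forall w, S w <-> exists x, unit_ball x /\ w = a + x *m A).

End Defs.

(* Main.v *)
(** Let h be the support function of K. On a complex k-plane P it is the support
    function of the projection of K, hence h(u) = Re <a_P, u> + sqrt (q_P u) with
    q_P a Hermitian form. The odd part of h and the square of its even part are
    thus the real part of a linear functional and a Hermitian form on every
    k-plane. Since k >= 2, any two vectors lie in a common k-plane, so both
    properties are global, the second one by Jordan and von Neumann's argument.
    So h(u) = Re <a, u> + |u M| with M invertible. The bound by h places K inside
    the ellipsoid a + (ball) M^*; conversely h is attained on K, and by the
    equality case of Cauchy-Schwarz the maximiser is the expected boundary point
    of the ellipsoid, so K contains the boundary and, by convexity, everything. *)
Require Import Defs.
From HB Require Import structures.
From mathcomp Require Import all_boot all_order all_algebra.
From mathcomp Require Import complex.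
From mathcomp Require Import reals.
From mathcomp Require Import boolp spectral ring lra.
Set Implicit Arguments.
Unset Strict Implicit.
Unset Printing Implicit Defensive.
Import Order.TTheory GRing.Theory Num.Theory.
Local Open Scope ring_scope.

(** * Hermitian and Euclidean geometry of row vectors *)

Section HermitianSpace.
Variable R : realType.
Local Notation C := R[i].

Definition adj (m n : nat) (A : 'M[C]_(m, n)) : 'M[C]_(n, m) := (map_mx conjc A)^T.

Definition rdot (n : nat) (u v : 'rV[C]_n) : R := complex.Re (hdot u v).

Lemma adjM m n p (A : 'M[C]_(m, n)) (B : 'M_(n, p)) : adj (A *m B) = adj B *m adj A.
Proof. by rewrite /adj map_mxM trmx_mul. Qed.

Lemma adjK m n (A : 'M[C]_(m, n)) : adj (adj A) = A.
Proof. by apply/matrixP => i j; rewrite !mxE conjcK. Qed.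

Lemma hdotE n (u v : 'rV[C]_n) : hdot u v = (u *m adj v) 0 0.
Proof. by rewrite mxE; apply: eq_bigr => i _; rewrite !mxE. Qed.

Lemma hdotMl m n (x : 'rV[C]_m) (A : 'M_(m, n)) u :
  hdot (x *m A) u = hdot x (u *m adj A).
Proof. by rewrite !hdotE adjM adjK mulmxA. Qed.

Lemma hdotDl n (u v w : 'rV[C]_n) : hdot (u + v) w = hdot u w + hdot v w.
Proof. by rewrite !hdotE mulmxDl mxE. Qed.

Lemma hdotZl n c (u v : 'rV[C]_n) : hdot (c *: u) v = c * hdot u v.
Proof. by rewrite !hdotE -scalemxAl mxE. Qed.

Lemma hdotC n (u v : 'rV[C]_n) : hdot v u = conjc (hdot u v).
Proof.
rewrite /hdot rmorph_sum; apply: eq_bigr => i _.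
by rewrite rmorphM /= conjcK mulrC.
Qed.

Lemma rdotC n (u v : 'rV[C]_n) : rdot u v = rdot v u.
Proof. by rewrite /rdot hdotC; case: hdot. Qed.

Lemma hdot0l n (u : 'rV[C]_n) : hdot 0 u = 0.
Proof. by rewrite hdotE mul0mx mxE. Qed.

Lemma rdot0l n (u : 'rV[C]_n) : rdot 0 u = 0.
Proof. by rewrite /rdot hdot0l. Qed.

Lemma rdotDl n (u v w : 'rV[C]_n) : rdot (u + v) w = rdot u w + rdot v w.
Proof. by rewrite /rdot hdotDl raddfD. Qed.

Lemma rdotDr n (u v w : 'rV[C]_n) : rdot w (u + v) = rdot w u + rdot w v.
Proof. by rewrite !(rdotC w) rdotDl. Qed.

Lemma rdotZl n (t : R) (u v : 'rV[C]_n) : rdot (t%:C%C *: u) v = t * rdot u v.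
Proof.
by rewrite /rdot hdotZl; case: hdot => a b /=; rewrite mul0r subr0.
Qed.

Lemma rdotZr n (t : R) (u v : 'rV[C]_n) : rdot u (t%:C%C *: v) = t * rdot u v.
Proof. by rewrite rdotC rdotZl rdotC. Qed.

Lemma rdotNl n (u v : 'rV[C]_n) : rdot (- u) v = - rdot u v.
Proof. by rewrite /rdot !hdotE mulNmx mxE raddfN. Qed.

Lemma rdotNr n (u v : 'rV[C]_n) : rdot u (- v) = - rdot u v.
Proof. by rewrite !(rdotC u) rdotNl. Qed.

Lemma rdotMl m n (x : 'rV[C]_m) (A : 'M_(m, n)) u :
  rdot (x *m A) u = rdot x (u *m adj A).
Proof. by rewrite /rdot hdotMl. Qed.

Lemma rdotZi n (u v : 'rV[C]_n) : rdot u (('i%C : C) *: v) = complex.Im (hdot u v).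
Proof.
rewrite rdotC /rdot hdotZl (hdotC u v); case: (hdot u v) => a b /=.
by rewrite mul0r mul1r sub0r opprK.
Qed.

(** Conjugate-linearity in the second argument turns the factor ['i] into the imaginary part, so the
    real product determines the Hermitian one. *)
Lemma hdot_rdot n (u v : 'rV[C]_n) :
  hdot u v = (rdot u v +i* rdot u (('i%C : C) *: v))%C.
Proof. by rewrite rdotZi /rdot; case: hdot. Qed.

Lemma hdotvv n (u : 'rV[C]_n) : hdot u u = (vnorm2 u)%:C%C.
Proof.
rewrite /hdot /vnorm2 raddf_sum; apply: eq_bigr => i _ /=.
case: (u 0 i) => a b /=; apply/eqP; rewrite eq_complex /=.
by apply/andP; split; apply/eqP; ring.
Qed.

Lemma rdotvv n (u : 'rV[C]_n) : rdot u u = vnorm2 u.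
Proof. by rewrite /rdot hdotvv. Qed.

Lemma vnorm2_ge0 n (u : 'rV[C]_n) : 0 <= vnorm2 u.
Proof.
by apply: sumr_ge0 => i _; case: (u 0 i) => a b; rewrite addr_ge0 ?sqr_ge0.
Qed.

Lemma vnorm2_0 n : vnorm2 (0 : 'rV[C]_n) = 0.
Proof. by rewrite -rdotvv rdot0l. Qed.

Lemma vnorm2_eq0 n (u : 'rV[C]_n) : vnorm2 u = 0 -> u = 0.
Proof.
move=> u0; apply/rowP => i; rewrite mxE.
have : \sum_(j < n) cnorm2 (u 0 j) == 0 by rewrite -[X in X == _]/(vnorm2 u) u0.
rewrite psumr_eq0 => [/allP/(_ i)|j _]; last first.
  by case: (u 0 j) => a b; rewrite addr_ge0 ?sqr_ge0.
rewrite mem_index_enum => /(_ isT) /=; case: (u 0 i) => a b /=.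
by rewrite paddr_eq0 ?sqr_ge0 // !sqrf_eq0 => /andP[/eqP-> /eqP->].
Qed.

Lemma vnorm2D n (u v : 'rV[C]_n) :
  vnorm2 (u + v) = vnorm2 u + vnorm2 v + rdot u v *+ 2.
Proof. by rewrite -!rdotvv rdotDl !rdotDr (rdotC v u); ring. Qed.

Lemma vnorm2N n (u : 'rV[C]_n) : vnorm2 (- u) = vnorm2 u.
Proof. by rewrite -!rdotvv rdotNl rdotNr opprK. Qed.

Lemma vnorm2B n (u v : 'rV[C]_n) :
  vnorm2 (u - v) = vnorm2 u + vnorm2 v - rdot u v *+ 2.
Proof. by rewrite vnorm2D vnorm2N rdotNr mulNrn. Qed.

Lemma vnorm2Z n (t : R) (u : 'rV[C]_n) : vnorm2 (t%:C%C *: u) = t ^+ 2 * vnorm2 u.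
Proof. by rewrite -!rdotvv rdotZl rdotZr; ring. Qed.

Lemma vnorm2_delta n (i : 'I_n) : vnorm2 (delta_mx 0 i : 'rV[C]_n) = 1.
Proof.
rewrite /vnorm2 (bigD1 i) //= big1 ?addr0 => [|j ji]; rewrite mxE ?eqxx /=.
  by rewrite expr1n expr0n addr0.
by rewrite (negbTE ji) /= expr0n addr0.
Qed.

(** At [x = 0] any unit vector serves; positive dimension provides one. *)
Lemma unit_multiple n (x : 'rV[C]_n.+1) :
  exists2 e : 'rV[C]_n.+1, vnorm2 e = 1 & x = (Num.sqrt (vnorm2 x))%:C%C *: e.
Proof.
have [x0|x0] := eqVneq (vnorm2 x) 0.
  exists (delta_mx 0 0); first exact: vnorm2_delta.
  by rewrite x0 sqrtr0 scale0r (vnorm2_eq0 x0).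
have s0 : Num.sqrt (vnorm2 x) != 0.
  by rewrite sqrtr_eq0 -ltNge lt_def x0 vnorm2_ge0.
exists ((Num.sqrt (vnorm2 x))^-1%:C%C *: x).
  by rewrite vnorm2Z exprVn sqr_sqrtr ?vnorm2_ge0 // mulVf.
by rewrite scalerA -rmorphM /= divff // scale1r.
Qed.

(** Cauchy-Schwarz, from expanding the squared norm of [s x - y] with [s] the norm of [y]. *)
Lemma rdot_le_ball n (x y : 'rV[C]_n) :
  vnorm2 x <= 1 -> rdot x y <= Num.sqrt (vnorm2 y).
Proof.
move=> x1; set s := Num.sqrt _.
have s2 : s ^+ 2 = vnorm2 y by rewrite sqr_sqrtr ?vnorm2_ge0.
have [s0|s0] := eqVneq s 0.
  have y0 : y = 0 by apply: vnorm2_eq0; rewrite -s2 s0 expr0n.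
  by rewrite s0 y0 rdotC rdot0l.
have sp : 0 < s by rewrite lt_def s0 sqrtr_ge0.
have := vnorm2_ge0 (s%:C%C *: x - y).
rewrite vnorm2B vnorm2Z rdotZl -s2 => H.
rewrite -(ler_pM2l sp); nra.
Qed.

End HermitianSpace.

(** * From complex planes to the whole space *)

Section Planewise.
Variable R : realType.
Local Notation C := R[i].

Lemma conj_semilinear_hdot n (L : 'rV[C]_n -> C) :
    {morph L : u v / u + v} -> (forall c u, L (c *: u) = conjc c * L u) ->
  exists a, forall u, L u = hdot a u.
Proof.
move=> LD LZ; exists (\row_i L (delta_mx 0 i)) => u.
have L0 : L 0 = 0 by rewrite -(scale0r (0 : 'rV_n)) LZ conjc0 mul0r.
rewrite [in LHS](row_sum_delta u) (big_morph L LD L0).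
by apply: eq_bigr => i _; rewrite LZ mxE mulrC.
Qed.

(** Additivity and homogeneity involve at most two vectors, so one plane suffices for each. Complex
    coefficients keep ['i u] in the plane of [u], which lets [l] be completed to a conjugate-linear
    [L] with real part [l]. *)
Lemma planewise_rdot n (l : 'rV[C]_n -> R) :
    (forall u v, exists a, forall c d,
       l (c *: u + d *: v) = rdot a (c *: u + d *: v)) ->
  exists a, forall u, l u = rdot a u.
Proof.
move=> lP; pose L u := (l u +i* l (('i%C : C) *: u))%C.
have lD : {morph l : u v / u + v}.
  move=> u v; have [a la] := lP u v.
  have := la 1 1; have := la 1 0; have := la 0 1.
  by rewrite !scale1r !scale0r addr0 add0r rdotDr => -> -> ->.
have LD : {morph L : u v / u + v}.
  by move=> u v; rewrite /L scalerDr !lD; apply/eqP; rewrite eq_complex /= !eqxx.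
have LZ c u : L (c *: u) = conjc c * L u.
  have [a la] := lP u 0.
  have {}la d : l (d *: u) = rdot a (d *: u).
    by have := la d 0; rewrite scaler0 addr0.
  have LE d : L (d *: u) = hdot a (d *: u).
    by rewrite /L scalerA !la -scalerA -hdot_rdot.
  rewrite -[X in _ = _ * L X]scale1r !LE scale1r.
  by rewrite !(hdotC _ a) hdotZl rmorphM.
have [a La] := conj_semilinear_hdot LD LZ.
by exists a => u; rewrite /rdot -La.
Qed.

Lemma planewise_hermitian n (g : 'rV[C]_n -> R) :
    (forall u v, exists m (B : 'M_(n, m)), forall c d,
       g (c *: u + d *: v) = vnorm2 ((c *: u + d *: v) *m B)) ->
  exists H : 'M[C]_n, H = adj H /\
    forall u, (u *m H *m adj u) 0 0 = (g u)%:C%C.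
Proof.
(* Real polarization of [g]; [F] completes it to a Hermitian form by the formula of [hdot_rdot]. *)
move=> gP; pose b u v := (g (u + v) - g (u - v)) / 4%:R.
pose F u v := (b u v +i* b u (('i%C : C) *: v))%C.
have gplane u v : exists m (B : 'M_(n, m)), forall c d c' d',
    b (c *: u + d *: v) (c' *: u + d' *: v) =
    rdot ((c *: u + d *: v) *m B) ((c' *: u + d' *: v) *m B).
  have [m [B gB]] := gP u v; exists m, B => c d c' d'.
  have sum : c *: u + d *: v + (c' *: u + d' *: v) = (c + c') *: u + (d + d') *: v.
    by rewrite !scalerDl addrACA.
  have diff : c *: u + d *: v - (c' *: u + d' *: v) = (c - c') *: u + (d - d') *: v.
    by rewrite opprD !scalerBl addrACA.
  by rewrite /b sum diff !gB -sum -diff mulmxDl mulmxBl vnorm2D vnorm2B; field.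
have FE u v : exists m (B : 'M_(n, m)), forall c d c' d',
    F (c *: u + d *: v) (c' *: u + d' *: v) =
    hdot ((c *: u + d *: v) *m B) ((c' *: u + d' *: v) *m B).
  have [m [B bB]] := gplane u v; exists m, B => c d c' d'.
  by rewrite /F scalerDr !scalerA !bB hdot_rdot -!scalerA -scalerDr scalemxAl.
have para u v : g (u + v) + g (u - v) = g u *+ 2 + g v *+ 2.
  have [m [B gB]] := gP u v.
  have := gB 1 1; have := gB 1 (-1); have := gB 1 0; have := gB 0 1.
  rewrite !scaleN1r !scale1r !scale0r addr0 add0r => -> -> -> ->.
  by rewrite mulmxDl mulmxBl vnorm2D vnorm2B; ring.
(* Jordan-von Neumann: subtract the parallelogram identities of
   (u + w, v + w) and (u - w, v - w). *)
have bD w : {morph b^~ w : u v / u + v}.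
  move=> u v; have := para (u + w) (v + w); have := para (u - w) (v - w).
  have -> : u - w - (v - w) = u - v by rewrite opprB addrA subrK.
  have -> : u + w - (v + w) = u - v by rewrite opprD addrACA subrr addr0.
  have -> : u + w + (v + w) = (u + v) + w + w by rewrite addrACA addrA.
  have -> : u - w + (v - w) = (u + v) - w - w by rewrite addrACA addrA.
  (* The difference of the two identities leaves [g] at [u + v + 2 w] and [u + v - 2 w]. Both points
     lie in the plane of [u + v] and [w], where [g] is a squared norm, so their difference is 8
     times [b (u + v) w]. *)
  have [m [B gB]] := gP (u + v) w.
  have e1 := gB 1 2; have e2 := gB 1 (-2); have e3 := gB 1 1; have e4 := gB 1 (-1).
  move: e1 e2 e3 e4.
  rewrite !scaleNr !scale1r scaler_nat mulr2n opprD !addrA.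
  rewrite /b !mulmxDl !mulNmx => -> -> -> ->.
  set x := u *m B + v *m B; set y := w *m B.
  rewrite !(vnorm2D, vnorm2N, rdotDl, rdotNr, rdotNl) rdotvv; lra.
have FD w : {morph F^~ w : u v / u + v}.
  by move=> u v; rewrite /F !bD; apply/eqP; rewrite eq_complex /= !eqxx.
have FC u v : F v u = conjc (F u v).
  have [m [B FB]] := FE u v.
  have := FB 1 0 0 1; have := FB 0 1 1 0.
  by rewrite !scale1r !scale0r addr0 add0r => -> ->; rewrite hdotC.
have FZ w c u : F (c *: u) w = c * F u w.
  have [m [B FB]] := FE u w.
  have := FB c 0 0 1; have := FB 1 0 0 1.
  by rewrite !scale1r !scale0r !addr0 add0r -scalemxAl hdotZl => -> ->.
have Fg u : F u u = (g u)%:C%C.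
  have [m [B FB]] := FE u 0; have [m' [B' gB]] := gP u 0.
  have := FB 1 0 1 0; rewrite !scale1r scale0r addr0 => Fu.
  apply/eqP; rewrite eq_complex; apply/andP; split; last by rewrite Fu hdotvv.
  (* On the diagonal, polarization compares [g] at [2 u] and at [0]; quadratic homogeneity then
     gives [g u]. *)
  have := gB 2 0; have := gB 1 0; have := gB 0 0.
  rewrite /F /b /= !scale0r !addr0 scale1r subrr scaler_nat mulr2n.
  move=> -> -> ->; rewrite (mul0mx _ B') mulmxDl vnorm2D.
  by rewrite vnorm2_0 rdotvv; apply/eqP; field.
clearbody F.
exists (\matrix_(i, j) F (delta_mx 0 i) (delta_mx 0 j)); split.
  by apply/matrixP => i j; rewrite !mxE FC.
have F0 w : F 0 w = 0 by rewrite -(scale0r (0 : 'rV_n)) FZ mul0r.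
have Fl u w : F u w = \sum_i u 0 i * F (delta_mx 0 i) w.
  rewrite [in LHS](row_sum_delta u) (big_morph (F^~ w) (FD w) (F0 w)).
  by apply: eq_bigr => i _; rewrite FZ.
move=> u; rewrite -Fg -mulmxA mxE Fl; apply: eq_bigr => i _; congr (_ * _).
rewrite FC Fl rmorph_sum mxE; apply: eq_bigr => j _.
by rewrite rmorphM /= -FC mulrC !mxE.
Qed.

(** Diagonalise [H] in a unitary basis and take the square root of the diagonal; positivity of [g]
    makes the resulting [M] injective. *)
Lemma posdef_factor n (H : 'M[C]_n) (g : 'rV[C]_n -> R) :
    H = adj H -> (forall u, (u *m H *m adj u) 0 0 = (g u)%:C%C) ->
    (forall u, u != 0 -> 0 < g u) ->
  exists2 M : 'M[C]_n, M \in unitmx & forall u, g u = vnorm2 (u *m M).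
Proof.
move=> Hh Hg gpos.
have Hnormal : H \is normalmx.
  apply/hermitian_normalmx/is_hermitianmxP.
  by rewrite expr0 scale1r {1}Hh /adj map_trmx.
have /orthomx_spectralP := Hnormal.
have := spectral_unitarymx H; set P := spectralmx H => Pu.
set D := spectral_diag H => HE.
have Pv : invmx P = adj P by rewrite invmx_unitary // /adj -map_trmx.
have Pun : P \in unitmx := unitarymx_unit Pu.
have g_ge0 u : 0 <= g u.
  have [->|/gpos/ltW//] := eqVneq u 0.
  by rewrite -lecR -(Hg 0) !mul0mx mxE.
(* The rows of [P] are unit eigenvectors, so the eigenvalues are values of [g], hence real and
   nonnegative. *)
have DE i : D 0 i = (g (row i P))%:C%C.
  rewrite -Hg.
  have -> : (row i P *m H *m adj (row i P)) 0 0 = (P *m H *m adj P) i i.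
    rewrite -row_mul !mxE; apply: eq_bigr => j _; by rewrite !mxE.
  rewrite {1}HE !mulmxA mulmxV // mul1mx -mulmxA -Pv mulmxV // mulmx1.
  by rewrite mxE eqxx.
pose S := diag_mx (\row_i (Num.sqrt (g (row i P)))%:C%C) : 'M[C]_n.
have SE : S *m adj S = diag_mx D.
  rewrite /adj map_diag_mx tr_diag_mx mulmx_diag; congr diag_mx.
  apply/rowP => i; rewrite !mxE DE [X in _ * X]conjc_real -rmorphM /=.
  by rewrite -expr2 sqr_sqrtr.
pose M := adj P *m S.
have gM u : g u = vnorm2 (u *m M).
  apply: (@complexI R); rewrite -hdotvv hdotE -Hg HE /M Pv.
  rewrite !adjM adjK !mulmxA; congr ((_ *m _) 0 0).
  by rewrite -!mulmxA [S *m (_ *m _)]mulmxA SE.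
exists M => //; rewrite -row_free_unit -kermx_eq0; apply/rowV0P => v.
move=> /sub_kermxP vM; apply/eqP/negPn/negP => /gpos.
by rewrite gM vM vnorm2_0 ltxx.
Qed.

End Planewise.

(** * Orthogonal projections, support functions and ellipsoids *)

Section Support.
Variable R : realType.
Local Notation C := R[i].

(** The rows of [B] are a basis of the subspace, so their Gram matrix [G] is invertible and solves
    the normal equations. *)
Lemma orth_proj_exists n (P : 'M[C]_n) v : exists w, is_orth_proj P v w.
Proof.
set B := row_base P; pose G := B *m adj B.
have Gu : G \in unitmx.
  rewrite -row_free_unit -kermx_eq0; apply/rowV0P => x /sub_kermxP xG.
  have : vnorm2 (x *m B) = 0 by rewrite -rdotvv rdotMl -mulmxA xG rdotC rdot0l.
  by move/vnorm2_eq0/eqP; rewrite mulmx_free_eq0 ?row_base_free // => /eqP.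
exists (v *m adj B *m invmx G *m B); split.
  by rewrite /in_subspace -(eq_row_base P) submxMl.
move=> u; rewrite /in_subspace -(eq_row_base P) => /submxP[y ->].
rewrite hdotC hdotMl hdotC conjcK mulmxBl.
by rewrite -[_ *m B *m _]mulmxA mulmxKV // subrr hdot0l.
Qed.

(** The first rows of [row_ebase M] span [u] and [v]; keeping [k] rows of this invertible matrix
    extends their span to rank [k]. *)
Lemma subspace_containing_pair n k (u v : 'rV[C]_n) :
    (2 <= k)%N -> (k <= n)%N ->
  exists2 P : 'M[C]_n, \rank P = k & (u <= P)%MS /\ (v <= P)%MS.
Proof.
move=> k2 kn; pose M := col_mx u v.
exists (pid_mx k *m row_ebase M).
  by rewrite mxrankMfree ?row_free_unit ?row_ebase_unit // rank_pid_mx.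
suff : (M <= (pid_mx k : 'M[C]_n) *m row_ebase M)%MS.
  by rewrite col_mx_sub => /andP[].
have rk : (\rank M <= k)%N by rewrite (leq_trans (rank_leq_row M)).
rewrite -{1}(mulmx_ebase M); apply/submxP; exists (col_ebase M *m pid_mx (\rank M)).
rewrite -!mulmxA (mulmxA (pid_mx _)) mul_pid_mx (minn_idPl rk).
by rewrite (minn_idPr (leq_trans rk kn)).
Qed.

(** The support function as a relation: the maximum has to be attained, and the maximisers later
    yield the boundary points of the ellipsoid. *)
Definition support_value n (K : 'rV[C]_n -> Prop) (u : 'rV[C]_n) (s : R) : Prop :=
  (exists2 v, K v & rdot v u = s) /\ forall v, K v -> rdot v u <= s.

Lemma support_value_uniq n (K : 'rV[C]_n -> Prop) u s t :
  support_value K u s -> support_value K u t -> s = t.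
Proof.
move=> [[v Kv <-] vmax] [[w Kw <-] wmax].
by apply/le_anti; rewrite wmax ?vmax.
Qed.

Lemma rdot_ball_attained m (y : 'rV[C]_m.+1) :
  exists2 x : 'rV[C]_m.+1, vnorm2 x <= 1 & rdot x y = Num.sqrt (vnorm2 y).
Proof.
have [e e1 ye] := unit_multiple y; exists e; first by rewrite e1.
by rewrite [in LHS]ye rdotZr rdotvv e1 mulr1.
Qed.

(* For u in P, the functional Re <., u> takes the same value at v and at its
   projection, so K and its projection have the same support value at u. *)
Lemma support_value_ellipsoid_proj n m P (K : 'rV[C]_n -> Prop) :
    ellipsoid_in m.+1 P (orth_proj_set P K) ->
  exists a (B : 'M[C]_(n, m.+1)), forall u, in_subspace P u ->
    support_value K u (rdot a u + Num.sqrt (vnorm2 (u *m B))).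
Proof.
move=> [a [A [_ [_ PK]]]]; exists a, (adj A) => u uP.
have proj v w : is_orth_proj P v w -> rdot v u = rdot w u.
  move=> [_ /(_ u uP) vw]; apply/eqP; rewrite -subr_eq0 -rdotNl -rdotDl.
  by rewrite /rdot vw.
split=> [|v Kv].
  have [x x1 xu] := rdot_ball_attained (u *m adj A).
  have [v [Kv vx]] := (PK (a + x *m A)).2 (ex_intro _ x (conj x1 erefl)).
  by exists v => //; rewrite (proj _ _ vx) rdotDl rdotMl xu.
have [w vw] := orth_proj_exists P v.
have [x [x1 wx]] := (PK w).1 (ex_intro _ v (conj Kv vw)).
by rewrite (proj _ _ vw) wx rdotDl rdotMl lerD2l rdot_le_ball.
Qed.

(** The sum [s + t] is the extent of [K] along [u], and [K] contains a segment in that direction. *)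
Lemma support_width_gt0 n (K : 'rV[C]_n -> Prop) u s t :
    nonempty_interior K -> support_value K u s -> support_value K (- u) t ->
  u != 0 -> 0 < s + t.
Proof.
move=> [v [e [e0 Kv]]] [_ smax] [_ tmax] u0.
have U : 0 < vnorm2 u.
  by rewrite lt_def vnorm2_ge0 andbT; apply: contra u0 => /eqP/vnorm2_eq0->.
(* Chosen so that [r u] has squared norm [e / 2], within the ball around [v]. *)
pose r := Num.sqrt (e / (vnorm2 u *+ 2)).
have q0 : 0 < e / (vnorm2 u *+ 2) by rewrite divr_gt0 // mulrn_wgt0.
have r0 : 0 < r by rewrite sqrtr_gt0.
have r2 : r ^+ 2 * vnorm2 u = e / 2.
  by rewrite sqr_sqrtr ?ltW //; field; rewrite gt_eqF.
have /smax : K (v + r%:C%C *: u).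
  by apply: Kv; rewrite addrAC subrr add0r vnorm2Z r2; lra.
have /tmax : K v by apply: Kv; rewrite subrr vnorm2_0.
rewrite rdotNr rdotDl rdotZl rdotvv.
have := mulr_gt0 r0 U; lra.
Qed.

Lemma ellipsoid_of_support n (K : 'rV[C]_n.+1 -> Prop) a (M : 'M[C]_n.+1) :
    convex_set K -> M \in unitmx ->
    (forall u, support_value K u (rdot a u + Num.sqrt (vnorm2 (u *m M)))) ->
  ellipsoid K.
Proof.
move=> Kconv Mu hK; pose A := adj M.
have Au : A \in unitmx by rewrite /A /adj unitmx_tr map_unitmx.
have hu x : support_value K (x *m invmx M)
    (rdot a (x *m invmx M) + Num.sqrt (vnorm2 x)).
  by have := hK (x *m invmx M); rewrite mulmxKV.
have rA x y : rdot (a + x *m A) (y *m invmx M) =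
    rdot a (y *m invmx M) + rdot x y.
  by rewrite rdotDl rdotMl /A adjK mulmxKV.
have inE v : K v -> exists2 x, vnorm2 x <= 1 & v = a + x *m A.
  move=> Kv; pose x := (v - a) *m invmx A.
  have vE : v = a + x *m A by rewrite mulmxKV // addrC subrK.
  exists x => //.
  (* Testing in the direction given by [x] itself yields [s ^+ 2 <= s], hence [s <= 1]. *)
  have [_ /(_ v Kv)] := hu x.
  rewrite vE rA lerD2l rdotvv.
  have := sqr_sqrtr (vnorm2_ge0 x); have := sqrtr_ge0 (vnorm2 x).
  set s := Num.sqrt _ => s0 <- ss; nra.
have sphere x : vnorm2 x = 1 -> K (a + x *m A).
  move=> x1; have [[v Kv]] := hu x.
  have [y y1 vE] := inE v Kv.
  rewrite {1}vE rA x1 sqrtr1 => /addrI xy _.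
  suff -> : x = y by rewrite -vE.
  (* Here [rdot y x = 1], so the squared norm of [y - x] is at most [1 + 1 - 2]. *)
  apply/eqP; rewrite eq_sym -subr_eq0; apply/eqP/vnorm2_eq0/le_anti.
  by rewrite vnorm2_ge0 andbT vnorm2B xy x1; lra.
exists a, A; split; first by move=> x y /addrI /(can_inj (mulmxK Au)).
move=> w; split=> [/inE[x]|[x [x1 ->]]]; first by exists x.
have [e e1 xe] := unit_multiple x; set s := Num.sqrt _ in xe.
have s1 : 0 <= s <= 1.
  by rewrite sqrtr_ge0 -sqrtr1 ler_wsqrtr.
(* The point lies on the chord joining the boundary points of [e] and [- e]; the weights differ by
   [s]. *)
have -> : a + x *m A = ((1 + s) / 2)%:C%C *: (a + e *m A)
    + (1 - (1 + s) / 2)%:C%C *: (a + (- e) *m A).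
  rewrite !scalerDr addrACA -scalerDl -rmorphD /= [_ + (1 - _)]addrC subrK scale1r.
  rewrite mulNmx scalerN -scalerBl -rmorphB /= {1}xe -scalemxAl.
  by congr (a + _%:C%C *: _); field.
apply: Kconv; [exact: sphere | by apply: sphere; rewrite vnorm2N |].
by case/andP: s1 => s0 s1; apply/andP; split; lra.
Qed.

End Support.

Theorem theorem4p2 (R : realType) (n k : nat) (K : 'rV[R[i]]_n -> Prop) :
  (2 <= k)%N -> (k < n)%N ->
  convex_body K ->
  (forall P : 'M[R[i]]_n, \rank P = k -> ellipsoid_in k P (orth_proj_set P K)) ->
  ellipsoid K.
Proof.
case: n K => // n K; case: k => // m k2 kn [_ Kconv Kint] KP.
have plane (u v : 'rV[R[i]]_n.+1) : exists a (B : 'M_(n.+1, m.+1)), forall c d,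
    let w := c *: u + d *: v in
    support_value K w (rdot a w + Num.sqrt (vnorm2 (w *m B))).
  have [P Pk [uP vP]] := subspace_containing_pair u v k2 (ltnW kn).
  have [a [B aB]] := support_value_ellipsoid_proj (KP P Pk).
  by exists a, B => c d; apply: aB; rewrite /in_subspace addmx_sub ?scalemx_sub.
have /choice[h hK] (u : 'rV_n.+1) : exists s, support_value K u s.
  have [a [B aB]] := plane u 0; eexists.
  by have := aB 1 0; rewrite /= scale1r scaler0 addr0; exact.
have {}plane (u v : 'rV_n.+1) : exists a (B : 'M_(n.+1, m.+1)), forall c d,
    let w := c *: u + d *: v in
    h w = rdot a w + Num.sqrt (vnorm2 (w *m B)) /\
    h (- w) = - rdot a w + Num.sqrt (vnorm2 (w *m B)).
  have [a [B aB]] := plane u v; exists a, B => c d w; split.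
    exact: support_value_uniq (hK _) (aB c d).
  (* The opposite vector lies in the same plane, so the same [a] and [B] describe [h] there. *)
  have := aB (- c) (- d); rewrite /= !scaleNr -opprD -/w rdotNr mulNmx vnorm2N.
  exact: support_value_uniq (hK _).
pose l u := (h u - h (- u)) / 2; pose g u := ((h u + h (- u)) / 2) ^+ 2.
have [a la] : exists a, forall u, l u = rdot a u.
  apply: planewise_rdot => u v; have [a [B aB]] := plane u v.
  by exists a => c d; rewrite /l; have [-> ->] := aB c d; field.
have [H [Hh Hg]] : exists H : 'M[R[i]]_n.+1, H = adj H /\
    forall u, (u *m H *m adj u) 0 0 = (g u)%:C%C.
  apply: planewise_hermitian => u v; have [b [B bB]] := plane u v.
  exists _, B => c d; rewrite -[RHS]sqr_sqrtr ?vnorm2_ge0 //.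
  by rewrite /g; have [-> ->] := bB c d; congr (_ ^+ 2); field.
have w_gt0 u : u != 0 -> 0 < h u + h (- u).
  exact: support_width_gt0 Kint (hK u) (hK (- u)).
(* This includes [u = 0], so that the square root of [g u] is everywhere the even part of [h]. *)
have w_ge0 u : 0 <= h u + h (- u).
  have [b [B bB]] := plane u 0; have := bB 1 0.
  rewrite /= scale1r scaler0 addr0 => -[-> ->].
  have := sqrtr_ge0 (vnorm2 (u *m B)); lra.
have g_gt0 u : u != 0 -> 0 < g u.
  by move=> /w_gt0 w; rewrite exprn_gt0 // divr_gt0.
have [M Mu gM] := posdef_factor Hh Hg g_gt0.
apply: (ellipsoid_of_support (a := a) Kconv Mu) => u.
rewrite -gM -la sqrtr_sqr ger0_norm ?divr_ge0 //.
by have -> : l u + (h u + h (- u)) / 2 = h u by rewrite /l; field.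
Qed.
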